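(* The only constant angle spacelike cylinders in $\mathbf{E}_1^3$ are planes: a spacelike cylinder is a constant angle surface if and only if it is (contained in) a spacelike affine plane.
   Context: $\mathbf{E}_1^3$ is $\mathbb{R}^3$ with the Lorentzian metric $\langle\,,\rangle=dx_1^2+dx_2^2-dx_3^2$. A vector $w$ is timelike if $\langle w,w\rangle<0$, and $|w|=\sqrt{|\langle w,w\rangle|}$. For timelike $a,b$ in the same timelike cone ($\langle a,b\rangle<0$) the hyperbolic angle is the unique $\theta\ge 0$ with $\langle a,b\rangle=-|a||b|\cosh\theta$. A smooth immersion of a connected surface is spacelike if the induced metric is Riemannian; equivalently its unit normal fields are timelike. It is a constant angle surface if there is a fixed timelike vector $U$ such that a unit normal field $\xi$, with its sign chosen so that it lies in the same timelike cone as $U$, makes a constant hyperbolic angle with $U$ (equivalently $\langle\xi,U\rangle$ is constant). A cylinder is a ruled surface parametrized by $x(s,t)=\gamma(s)+tv$, $(s,t)\in I\times\mathbb{R}$, where $\gamma:I\to\mathbf{E}_1^3$ is a regular curve on an interval $I$ and $v$ is a fixed vector, with $\gamma'(s)$ and $v$ linearly independent for every $s$. *)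

(* Defs.v *)
From HB Require Import structures.
From mathcomp Require Import all_boot all_order all_algebra.
From mathcomp Require Import all_classical all_reals all_analysis.

Set Implicit Arguments.
Unset Strict Implicit.
Unset Printing Implicit Defensive.

Import Order.TTheory GRing.Theory Num.Theory.
Import numFieldNormedType.Exports.

Local Open Scope classical_set_scope.
Local Open Scope ring_scope.

(* The underlying space of E_1^3 is 'rV[R]_3; the x_3 axis is the column of
   index 2. *)
Definition lorentz (R : realType) (u w : 'rV[R]_3) : R :=
  u 0 0 * w 0 0 + u 0 1 * w 0 1 - u 0 2 * w 0 2.

Definition timelike (R : realType) (w : 'rV[R]_3) : Prop := lorentz w w < 0.

Definition lorentz_norm (R : realType) (w : 'rV[R]_3) : R :=
  Num.sqrt `|lorentz w w|.

Definition same_timelike_cone (R : realType) (a b : 'rV[R]_3) : Prop :=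
  [/\ timelike a, timelike b & lorentz a b < 0].

Definition cosh (R : realType) (t : R) : R := (expR t + expR (- t)) / 2.

Definition is_hyperbolic_angle (R : realType) (a b : 'rV[R]_3) (t : R) : Prop :=
  [/\ same_timelike_cone a b, 0 <= t &
      lorentz a b = - (lorentz_norm a * lorentz_norm b * cosh t)].

(* C^oo on a neighbourhood of D: on an open set containing D, all iterated
   directional derivatives of f (including f itself, ws = [::]) are
   differentiable. For open D this is smoothness on D; in general it is the
   usual convention for non-open domains such as closed intervals. *)
Definition smooth_on (R : realType) (V W : normedModType R)
    (D : set V) (f : V -> W) : Prop :=
  exists O : set V, [/\ open O, D `<=` O &
    forall (ws : seq V) (p : V), O p ->
      differentiable (foldr (fun w g => fun q => 'D_w g q) f ws) p].

(* Parametrized surfaces are maps x : R * R -> 'rV[R]_3 considered on a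
   parameter domain D. *)
Definition smooth_immersion (R : realType) (D : set (R * R))
    (x : R * R -> 'rV[R]_3) : Prop :=
  smooth_on D x /\ forall p, D p -> injective ('d x p).

Definition induced_metric (R : realType) (x : R * R -> 'rV[R]_3)
    (p w1 w2 : R * R) : R :=
  lorentz ('d x p w1) ('d x p w2).

Definition spacelike_surface (R : realType) (D : set (R * R))
    (x : R * R -> 'rV[R]_3) : Prop :=
  smooth_immersion D x /\
  forall p w, D p -> w != 0 -> 0 < induced_metric x p w w.

Definition unit_normal_field (R : realType) (D : set (R * R))
    (x xi : R * R -> 'rV[R]_3) : Prop :=
  smooth_on D xi /\
  forall p, D p ->
    lorentz_norm (xi p) = 1 /\ forall w, lorentz (xi p) ('d x p w) = 0.

(* The sign choice for xi is enforced by is_hyperbolic_angle, which requires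
   xi p and U to lie in the same timelike cone. *)
Definition constant_angle_surface (R : realType) (D : set (R * R))
    (x : R * R -> 'rV[R]_3) : Prop :=
  exists (U : 'rV[R]_3) (xi : R * R -> 'rV[R]_3) (theta : R),
    [/\ timelike U, unit_normal_field D x xi &
        forall p, D p -> is_hyperbolic_angle (xi p) U theta].

Definition regular_curve (R : realType) (I : set R) (gamma : R -> 'rV[R]_3) :
    Prop :=
  [/\ is_interval I, I° !=set0, smooth_on I gamma &
      forall s, I s -> derive1 gamma s != 0].

Definition cylinder (R : realType) (gamma : R -> 'rV[R]_3) (v : 'rV[R]_3) :
    R * R -> 'rV[R]_3 :=
  fun p => gamma p.1 + p.2 *: v.

Definition cylinder_data (R : realType) (I : set R) (gamma : R -> 'rV[R]_3)
    (v : 'rV[R]_3) : Prop :=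
  regular_curve I gamma /\ forall s, I s -> free [:: derive1 gamma s; v].

Definition affine_plane (R : realType) (q0 : 'rV[R]_3)
    (W : {vspace 'rV[R]_3}) : set 'rV[R]_3 :=
  [set q | q - q0 \in W].

Definition spacelike_affine_plane (R : realType) (P : set 'rV[R]_3) : Prop :=
  exists (q0 : 'rV[R]_3) (W : {vspace 'rV[R]_3}),
    [/\ P = affine_plane q0 W, \dim W = 2 &
        forall w, w \in W -> w != 0 -> 0 < lorentz w w].

(* Main.v *)
Require Import Defs.
From HB Require Import structures.
From mathcomp Require Import all_boot all_order all_algebra.
From mathcomp Require Import all_classical all_reals all_analysis.
From mathcomp Require Import ring lra.

Set Implicit Arguments.
Unset Strict Implicit.
Unset Printing Implicit Defensive.

Import Order.TTheory GRing.Theory Num.Theory.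
Import numFieldNormedType.Exports.
Local Open Scope classical_set_scope.
Local Open Scope ring_scope.

(* Let n be the unit normal along the ruling base t = 0.  It is orthogonal to
   the spacelike direction v, has norm -1 and a fixed product with U, so its
   Gram matrix against v and U is constant.  The square of det(v, U, n) is
   therefore constant; being continuous on an interval, this determinant is
   constant, and v, U and det(v, U, .) together determine n.  As n is constant
   and orthogonal to gamma', the product of n with gamma is constant, so the
   cylinder lies in an affine plane orthogonal to the timelike vector n.
   Conversely the unit normal of a spacelike plane containing the cylinder
   makes the constant angle 0 with itself. *)

(** * Linear algebra of the Lorentzian product *)

Section LorentzAlgebra.
Variable R : realType.
Implicit Types (a b u w n : 'rV[R]_3) (k : R).

Lemma rv3P a b : a 0 0 = b 0 0 -> a 0 1 = b 0 1 -> a 0 2 = b 0 2 -> a = b.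
Proof.
move=> h0 h1 h2; apply/rowP => -[[|[|[|//]]] hi].
- by rewrite (_ : Ordinal hi = 0) //; apply: val_inj.
- by rewrite (_ : Ordinal hi = 1) //; apply: val_inj.
- by rewrite (_ : Ordinal hi = 2) //; apply: val_inj.
Qed.

Lemma lorentzC a b : lorentz a b = lorentz b a.
Proof. rewrite /lorentz; ring. Qed.

Lemma lorentz_is_linear u : linear (lorentz u : 'rV[R]_3 -> R^o).
Proof.
by move=> k a b; rewrite /lorentz !mxE /GRing.scale /=; ring.
Qed.

HB.instance Definition _ u := GRing.isLinear.Build R 'rV[R]_3 R^o *:%R
  (lorentz u : 'rV[R]_3 -> R^o) (lorentz_is_linear u).

Lemma lorentzD u a b : lorentz u (a + b) = lorentz u a + lorentz u b.
Proof. by rewrite /lorentz !mxE; ring. Qed.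

Lemma lorentzB u a b : lorentz u (a - b) = lorentz u a - lorentz u b.
Proof. by rewrite /lorentz !mxE; ring. Qed.

Lemma lorentzZ u k a : lorentz u (k *: a) = k * lorentz u a.
Proof. by rewrite /lorentz !mxE; ring. Qed.

Lemma continuous_lorentz u : continuous (lorentz u : 'rV[R]_3 -> R).
Proof.
move=> w.
have h i : (fun z : 'rV[R]_3 => u 0 i * z 0 i) @ w --> u 0 i * w 0 i.
  apply: (@cvgM R _ (nbhs w) _ (cst (u 0 i)) (fun z : 'rV[R]_3 => z 0 i)).
    exact: cvg_cst.
  exact: coord_continuous.
exact: (cvgB (cvgD (h 0) (h 1)) (h 2)).
Qed.

Lemma spacelike_orthogonal u w :
  timelike u -> lorentz u w = 0 -> w != 0 -> 0 < lorentz w w.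
Proof.
rewrite /timelike /lorentz => hu huw w0.
set u0 := u 0 0 in hu huw *; set u1 := u 0 1 in hu huw *.
set u2 := u 0 2 in hu huw *.
have [h|h] := eqVneq (w 0 0 * w 0 0 + w 0 1 * w 0 1) 0.
  have e0 : w 0 0 = 0 by nra.
  have e1 : w 0 1 = 0 by nra.
  have u20 : u2 != 0 by apply/eqP => u20; rewrite u20 in hu; nra.
  case/eqP: w0; apply: rv3P; rewrite !mxE //.
  move: huw; rewrite e0 e1 !mulr0 add0r sub0r => /eqP.
  by rewrite oppr_eq0 mulf_eq0 (negbTE u20) => /eqP.
have hp : 0 < w 0 0 * w 0 0 + w 0 1 * w 0 1 by rewrite lt_def h; nra.
have u2p : 0 < u2 * u2 by nra.
rewrite -(pmulr_rgt0 _ u2p).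
(* Lagrange's identity in the first two coordinates. The last summand contains the factor
   [lorentz u w], which vanishes; the first is positive because [u] is timelike. *)
have -> : u2 * u2 * (w 0 0 * w 0 0 + w 0 1 * w 0 1 - w 0 2 * w 0 2) =
  (u2 * u2 - u0 * u0 - u1 * u1) * (w 0 0 * w 0 0 + w 0 1 * w 0 1)
  + (u0 * w 0 1 - u1 * w 0 0) ^+ 2
  + (u0 * w 0 0 + u1 * w 0 1 - u2 * w 0 2) *
    (u0 * w 0 0 + u1 * w 0 1 + u2 * w 0 2) by ring.
rewrite huw mul0r addr0 ltr_wpDr ?sqr_ge0 // mulr_gt0 //; lra.
Qed.

(** The Lorentzian cross product: the Euclidean one with its last coordinate negated, so that
    pairing it with [u] gives det(a, b, u). *)
Definition lcross a b : 'rV[R]_3 :=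
  \row_(i < 3) (if i == 0 then a 0 1 * b 0 2 - a 0 2 * b 0 1
  else if i == 1 then a 0 2 * b 0 0 - a 0 0 * b 0 2
  else a 0 1 * b 0 0 - a 0 0 * b 0 1).

Lemma lorentz_lcrossl a b : lorentz (lcross a b) a = 0.
Proof. rewrite /lorentz !mxE /=; ring. Qed.

Lemma lorentz_lcrossr a b : lorentz (lcross a b) b = 0.
Proof. rewrite /lorentz !mxE /=; ring. Qed.

(* [lorentz (lcross a b) u] is the determinant of (a, b, u), whose square is
   minus the Gram determinant because the metric has determinant -1. *)
Lemma lorentz_lcross_gram a b u :
  lorentz (lcross a b) u ^+ 2 =
  - (lorentz u u * (lorentz a a * lorentz b b - lorentz a b ^+ 2)
     - lorentz u a * (lorentz u a * lorentz b b - lorentz a b * lorentz u b)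
     + lorentz u b * (lorentz u a * lorentz a b - lorentz a a * lorentz u b)).
Proof. rewrite /lorentz !mxE /=; ring. Qed.

Lemma lorentz_lcross_sqr a b :
  lorentz (lcross a b) (lcross a b) =
  lorentz a b ^+ 2 - lorentz a a * lorentz b b.
Proof. rewrite /lorentz !mxE /=; ring. Qed.

(** The square of the cross product is minus the Gram determinant of [a] and [b], which is positive
    where the product is positive definite. *)
Lemma timelike_lcross (W : {vspace 'rV[R]_3}) a b :
  (forall w, w \in W -> w != 0 -> 0 < lorentz w w) ->
  a \in W -> b \in W -> free [:: a; b] -> timelike (lcross a b).
Proof.
move=> Wpos aW bW fab.
have b0 : b != 0 by move: fab; rewrite free_cons seq1_free => /andP[].
have bp := Wpos _ bW b0.
have aNb : a \notin <[b]>%VS.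
  by move: fab; rewrite free_cons span_seq1 => /andP[].
(* Gram-Schmidt without denominators: the part of [a] orthogonal to [b], scaled by [lorentz b b].
   Its square is [lorentz b b] times the Gram determinant. *)
pose w := lorentz b b *: a - lorentz a b *: b.
have wW : w \in W by rewrite memvB ?memvZ.
have w0 : w != 0.
  apply: contraNneq aNb => /eqP; rewrite subr_eq0 => /eqP e.
  apply/vlineP; exists ((lorentz b b)^-1 * lorentz a b).
  by rewrite -scalerA -e scalerA mulVf ?gt_eqF ?scale1r.
have := Wpos _ wW w0.
have -> : lorentz w w =
    lorentz b b * - lorentz (lcross a b) (lcross a b).
  rewrite lorentz_lcross_sqr /w lorentzB !lorentzZ.
  rewrite ![lorentz (_ - _) _]lorentzC !lorentzB !lorentzZ.
  rewrite (lorentzC b a); ring.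
by rewrite pmulr_rgt0 // oppr_gt0.
Qed.

Lemma lorentz_norm_timelike u :
  timelike u -> lorentz u u = - lorentz_norm u ^+ 2.
Proof.
by move=> hu; rewrite /lorentz_norm sqr_sqrtr // ltr0_norm // opprK.
Qed.

Lemma lorentz_normal_spacelike_plane (W : {vspace 'rV[R]_3}) :
  \dim W = 2 -> (forall w, w \in W -> w != 0 -> 0 < lorentz w w) ->
  exists n, lorentz n n = -1 /\ forall w, w \in W -> lorentz n w = 0.
Proof.
(* The basis tuple is generalized so that its length can be rewritten to 2 and its two vectors
   extracted. *)
move=> dW Wpos; have := vbasisP W; move: (vbasis W); rewrite dW => X bX.
have fX := basis_free bX; have mX := basis_mem bX; have sX := span_basis bX.
move: X bX fX mX sX => [[|a [|b [|//]]] //= sz] bX fX mX sX.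
have aW : a \in W by apply: mX; rewrite !inE eqxx.
have bW : b \in W by apply: mX; rewrite !inE eqxx orbT.
have tm := timelike_lcross Wpos aW bW fX.
set m := lcross a b in tm *.
have m0 : 0 < lorentz_norm m by rewrite sqrtr_gt0 normr_gt0 lt_eqF.
exists ((lorentz_norm m)^-1 *: m); split.
  rewrite lorentzZ lorentzC lorentzZ lorentz_norm_timelike //.
  by field; rewrite gt_eqF.
move=> w; rewrite -sX /= span_cons span_seq1 => /memv_addP[x /vlineP[k ->]].
move=> [y /vlineP[l ->] ->].
rewrite lorentzC lorentzZ lorentzC lorentzD !lorentzZ lorentz_lcrossl.
by rewrite lorentz_lcrossr !mulr0 addr0 mulr0.
Qed.

(** The plane is the kernel of [lorentz u], a functional that is nonzero at [u] itself, so
    rank-nullity gives dimension 2. *)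
Lemma spacelike_plane_orthogonal u :
  timelike u -> exists W : {vspace 'rV[R]_3}, [/\ \dim W = 2,
    forall w, (w \in W) = (lorentz u w == 0) &
    forall w, w \in W -> w != 0 -> 0 < lorentz w w].
Proof.
move=> tu; pose f : 'Hom('rV[R]_3, R^o) := linfun (lorentz u).
have fE w : f w = lorentz u w by rewrite lfunE.
have mE w : (w \in lker f) = (lorentz u w == 0) by rewrite memv_ker fE.
exists (lker f); split => //; last first.
  by move=> w; rewrite mE => /eqP; exact: spacelike_orthogonal.
have := limg_ker_dim f fullv; rewrite capfv dimvf.
suff -> : \dim (f @: fullv) = 1%N.
  by rewrite /dim /= mul1n addn1 => -[].
apply/eqP; rewrite eqn_leq; apply/andP; split.
  by have := dimvS (subvf (f @: fullv)); rewrite dimvf.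
rewrite lt0n dimv_eq0; apply/eqP => e.
have : f u \in (f @: fullv)%VS by rewrite memv_img ?memvf.
by rewrite e memv0 fE lt_eqF.
Qed.

(* A nonzero difference would be null and orthogonal to the timelike [U]. *)
Lemma lorentz_determined v U a b :
  0 < lorentz v v -> timelike U ->
  lorentz v a = lorentz v b -> lorentz U a = lorentz U b ->
  lorentz (lcross v U) a = lorentz (lcross v U) b -> a = b.
Proof.
move=> hv hU ev eU ec.
have dv : lorentz v (a - b) = 0 by rewrite lorentzB ev subrr.
have dU : lorentz U (a - b) = 0 by rewrite lorentzB eU subrr.
have dc : lorentz (lcross v U) (a - b) = 0 by rewrite lorentzB ec subrr.
apply/eqP; rewrite -subr_eq0; apply/negPn/negP => d0.
have := spacelike_orthogonal hU dU d0; move: d0 => _.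
(* Orthogonality to [v] and [U] reduces the Gram identity to a product of the square of [a - b] and
   the Gram determinant of [v] and [U], which is negative. *)
have := lorentz_lcross_gram v U (a - b).
rewrite dc (lorentzC (a - b) v) (lorentzC (a - b) U) dv dU => e h; move: hU; rewrite /timelike => hU.
have hG : lorentz v v * lorentz U U - lorentz v U ^+ 2 < 0 by nra.
move: e; rewrite expr0n /=; nra.
Qed.

End LorentzAlgebra.

(** * Constancy and derivatives on intervals, endpoints included *)

Section IntervalCalculus.
Variable R : realType.
Implicit Types (I : set R) (f : R -> R).

Lemma interval_segment I a b :
  is_interval I -> I a -> I b -> `[a, b]%classic `<=` I.
Proof. by move=> hI Ia Ib z /=; rewrite in_itv; exact: hI. Qed.

(** Two distinct values would be opposite; the intermediate value theorem then gives a zero, which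
    forces the constant square to be 0. *)
Lemma cst_of_cst_sqr I f :
  is_interval I -> (forall s, I s -> {for s, continuous f}) ->
  (forall s t, I s -> I t -> f s ^+ 2 = f t ^+ 2) ->
  forall s t, I s -> I t -> f s = f t.
Proof.
move=> hI cf hf.
suff H s t : s <= t -> I s -> I t -> f s = f t.
  by move=> s t Is It; have [?|/ltW ?] := leP s t; [|symmetry]; apply: H.
move=> st Is It; apply/eqP/negPn/negP => fst.
have /eqP := hf _ _ Is It; rewrite eqf_sqr (negbTE fst) /= => /eqP e.
have sI := interval_segment hI Is It.
have wf : {within `[s, t], continuous f}.
  by apply: continuous_in_subspaceT => z /set_mem /sI; exact: cf.
have : Num.min (f s) (f t) <= 0 <= Num.max (f s) (f t).
  by rewrite ge_min le_max e oppr_le0 oppr_ge0 le_total orbC le_total.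
move=> /(IVT st wf)[c cst' fc0].
have := hf _ _ Is (sI _ cst'); rewrite fc0 expr0n /= => /eqP.
rewrite sqrf_eq0 => /eqP f0; case/eqP: fst; move: e.
by rewrite f0 => /esym/eqP; rewrite oppr_eq0 => /eqP.
Qed.

Lemma cst_of_derive0 I f :
  is_interval I -> (forall s, I s -> is_derive s 1 f 0) ->
  forall s t, I s -> I t -> f s = f t.
Proof.
move=> hI df.
suff H s t : s <= t -> I s -> I t -> f s = f t.
  by move=> s t Is It; have [?|/ltW ?] := leP s t; [|symmetry]; apply: H.
move=> st Is It.
have sI := interval_segment hI Is It.
have wf : {within `[s, t], continuous f}.
  apply: continuous_in_subspaceT => z /set_mem /sI Iz.
  by apply/differentiable_continuous/derivable1_diffP; have [] := df z Iz.
have dfi z : z \in `]s, t[%R -> is_derive z 1 f (cst 0 z).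
  by move=> zst; apply/df/sI/subset_itv_oo_cc.
have [c _ /eqP] := MVT_segment st dfi wf.
by rewrite mul0r subr_eq0 => /eqP.
Qed.

Lemma nondegenerate_interval_accumulation I s :
  is_interval I -> I° !=set0 -> I s ->
  forall A : set R, (\forall h \near (0 : R)^', A h) ->
  exists2 h, A h & I (s + h).
Proof.
move=> hI [c /nbhs_ballP[e /= e0 ce]] Is A /nbhs_ballP[r /= r0 rA].
have [t It ts] : exists2 t, I t & t != s.
  have [cs|?] := eqVneq c s; last by exists c => //; apply/ce/ballxx.
  exists (c + e / 2); last by rewrite cs -subr_eq0 addrAC subrr add0r
    mulf_neq0 ?gt_eqF // invr_gt0.
  by apply: ce; rewrite /ball /= opprD addNKr normrN gtr0_norm ?divr_gt0 //; lra.
pose d := t - s; have d0 : d != 0 by rewrite subr_eq0.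
have dp : 0 < `|d| by rewrite normr_gt0.
(* This ratio satisfies both [k < 1], keeping [s + k * d] between [s] and [t], and [k * |d| < r]. *)
pose k := r / (r + `|d|).
have rd : 0 < r + `|d| by rewrite addr_gt0.
have k0 : 0 < k by rewrite divr_gt0.
have k1 : k < 1 by rewrite ltr_pdivrMr // mul1r ltrDl.
exists (k * d).
  apply: rA; last by rewrite mulf_neq0 // gt_eqF.
  rewrite /ball /= sub0r normrN normrM gtr0_norm //.
  rewrite mulrAC ltr_pdivrMr // mulrDr ltrDr mulr_gt0 //.
have [h|/ltW h] := leP s t.
  apply: (hI _ _ Is It); rewrite /d; apply/andP; split; nra.
apply: (hI _ _ It Is); rewrite /d; apply/andP; split; nra.
Qed.

(* The derivative is two-sided also when [s] is an endpoint of [I]. *)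
Lemma derive0_of_cst I f s :
  is_interval I -> I° !=set0 -> I s ->
  (forall t, I t -> f t = f s) -> derivable f s 1 -> 'D_1 f s = 0.
Proof.
move=> hI I0 Is fc df; apply/eqP/negPn/negP => d0.
have hl : (h^-1 *: ((f \o shift s) (h *: (1 : R)) - f s)) @[h --> 0^'] --> 'D_1 f s
  by exact: df.
(* A nonzero limit makes all difference quotients with small increments nonzero, yet an increment
   that stays in [I] gives quotient 0. *)
have [h + Ih] := nondegenerate_interval_accumulation hI I0 Is
  (cvgr_neq0 _ hl d0).
by rewrite /= /shift /= [h *: 1]mulr1 (addrC h) fc // subrr scaler0 eqxx.
Qed.

End IntervalCalculus.

Lemma smooth_on_differentiable (R : realType) (V W : normedModType R) (D : set V)
    (f : V -> W) p : smooth_on D f -> D p -> differentiable f p.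
Proof. by move=> [A [_ DA h]] Dp; exact: (h [::] p (DA _ Dp)). Qed.

Lemma smooth_on_cst (R : realType) (V W : normedModType R) (D : set V) (c : W) :
  smooth_on D (fun _ : V => c).
Proof.
exists setT; split; [exact: openT | by [] | move=> ws p _].
(* The constant is left existential because it becomes 0 after the first derivative. *)
suff [c' ->] : exists c', foldr (fun (z : V) (g : V -> W) q => 'D_z g q)
    (fun=> c) ws = cst c' by exact: differentiable_cst.
elim: ws => [|z ws [c' IH]]; first by exists c.
by exists 0; apply/funext => q; rewrite /= IH derive_cst.
Qed.

(** * Differentiating Lorentzian products and the cylinder map *)

Section LorentzCalculus.
Variable R : realType.
Implicit Types (gamma : R -> 'rV[R]_3) (u v : 'rV[R]_3) (p w : R * R).

Lemma is_derive_lorentz u gamma s :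
  derivable gamma s 1 ->
  is_derive s 1 (fun t => lorentz u (gamma t)) (lorentz u (derive1 gamma s)).
Proof.
move=> dg.
have h : (k^-1 *: (((fun t => lorentz u (gamma t)) \o shift s) (k *: (1 : R))
    - lorentz u (gamma s))) @[k --> 0^'] --> lorentz u (derive1 gamma s).
  rewrite derive1E.
  apply: cvg_trans (continuous_cvg _ (@continuous_lorentz _ u _) dg).
  by apply: near_eq_cvg; near=> k; rewrite /= lorentzZ lorentzB.
by apply: DeriveDef; [apply/cvg_ex; eexists; exact: h | exact: cvg_lim h].
Unshelve. all: by end_near. Qed.

Lemma diff_cylinder gamma v p w :
  differentiable (cylinder gamma v) p ->
  'd (cylinder gamma v) p w = w.1 *: derive1 gamma p.1 + w.2 *: v.
Proof.
move=> dx.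
case: w => a b /=.
have -> : (a, b) = a *: ((1, 0) : R * R) + b *: ((0, 1) : R * R).
  apply: injective_projections; rewrite /= scaler0 ?addr0 ?add0r;
    by rewrite [_ *: 1]mulr1.
rewrite linearD !linearZ.
rewrite -!deriveE // derive1E; congr (_ *: _ + _ *: _).
  (* Along (1, 0) the term in [v] cancels, leaving the difference quotient of [gamma]. *)
  rewrite /derive; do 4?f_equal; apply/funext => h.
  by rewrite /cylinder /= scaler0 add0r opprD addrACA subrr addr0.
(* Along (0, 1) the difference quotient equals [v] for every nonzero increment. *)
apply: cvg_lim => //; apply: cvg_trans (cvg_cst v).
apply: near_eq_cvg; near=> h.
rewrite /cylinder /= scaler0 [h *: 1]mulr1 add0r opprD.
rewrite addrACA subrr add0r -scalerBl addrK.
rewrite scalerA mulVf ?scale1r //.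
by near: h; exact: nbhs_dnbhs_neq.
Unshelve.
- exact: dnbhs_filter.
- by end_near.
Qed.

Lemma lorentz_diff_cylinder gamma v p u :
  differentiable (cylinder gamma v) p ->
  (forall w, lorentz u ('d (cylinder gamma v) p w) = 0) <->
  lorentz u (derive1 gamma p.1) = 0 /\ lorentz u v = 0.
Proof.
move=> dx; split=> [h|[hg hv] w]; last first.
  by rewrite diff_cylinder // lorentzD !lorentzZ hg hv !mulr0 addr0.
split; [have := h (1, 0)|have := h (0, 1)];
  by rewrite diff_cylinder //= scale1r scale0r ?addr0 ?add0r.
Qed.

End LorentzCalculus.

(** * Constancy of the unit normal, and the two implications *)

Lemma normal_cst (R : realType) (I : set R) (n : R -> 'rV[R]_3)
    (v U : 'rV[R]_3) (c : R) :
  is_interval I -> (forall s, I s -> {for s, continuous n}) ->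
  0 < lorentz v v -> timelike U ->
  (forall s, I s -> lorentz (n s) (n s) = -1) ->
  (forall s, I s -> lorentz v (n s) = 0) ->
  (forall s, I s -> lorentz U (n s) = c) ->
  forall s t, I s -> I t -> n s = n t.
Proof.
move=> hI cn vp tU nn nv nU s t Is It.
apply: (lorentz_determined vp tU); rewrite ?nv ?nU //.
apply: (cst_of_cst_sqr (f := fun z => lorentz (lcross v U) (n z)) hI) => //.
  by move=> z Iz; apply: continuous_comp (cn z Iz) (@continuous_lorentz _ _ _).
move=> y z Iy Iz; rewrite !lorentz_lcross_gram !nn //.
by rewrite !(lorentzC (n _)) !nv // !nU.
Qed.

Theorem theorem5p1 (R : realType) (I : set R) (gamma : R -> 'rV[R]_3)
    (v : 'rV[R]_3) :
  cylinder_data I gamma v ->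
  spacelike_surface (I `*` setT) (cylinder gamma v) ->
  (constant_angle_surface (I `*` setT) (cylinder gamma v) <->
   exists P : set 'rV[R]_3,
     spacelike_affine_plane P /\ cylinder gamma v @` (I `*` setT) `<=` P).
Proof.
move=> [[hI I0 sg _] _] [[sx _] xpos].
have [s0 /nbhs_singleton Is0] := I0.
have dg s : I s -> derivable gamma s 1.
  by move=> Is; apply/derivable1_diffP/(smooth_on_differentiable sg Is).
have dx p : I p.1 -> differentiable (cylinder gamma v) p.
  by move=> Ip; apply: (smooth_on_differentiable sx).
split=> [[U [xi [theta [tU [sxi nxi] axi]]]]|].
  pose n s := xi (s, 0).
  have Dp s : I s -> (I `*` [set: R]) (s, 0) by [].
  have nort s (Is : I s) :=
    (lorentz_diff_cylinder (n s) (dx (s, 0) Is)).1 (nxi _ (Dp s Is)).2.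
  have nn s : I s -> lorentz (n s) (n s) = -1.
    move=> Is; have [[tn _ _] _ _] := axi _ (Dp s Is).
    by rewrite lorentz_norm_timelike // (nxi _ (Dp s Is)).1 expr1n.
  have vp : 0 < lorentz v v.
    (* [v] is the image of (0, 1) under the differential, hence spacelike. *)
    have := xpos (s0, 0) (0, 1) (Dp _ Is0).
    rewrite /induced_metric diff_cylinder; last exact: dx.
    rewrite /= scale0r scale1r add0r; apply.
    by rewrite xpair_eqE oner_eq0 andbF.
  have ncst s : I s -> n s = n s0.
    move=> Is; apply: (normal_cst (I := I) (v := v) (U := U)
      (c := - (lorentz_norm U * cosh theta))) => // {Is} {}s Is.
    - apply: (@continuous_comp _ _ _ (fun z : R => (z, 0 : R)) xi).
        exact: (cvg_pair cvg_id (cvg_cst (0 : R))).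
      exact/differentiable_continuous/(smooth_on_differentiable sxi)/Dp.
    - by rewrite lorentzC; have [] := nort s Is.
    - rewrite lorentzC; have [_ _ ->] := axi _ (Dp s Is).
      by rewrite (nxi _ (Dp s Is)).1 mul1r.
  have tn : timelike (n s0) by rewrite /timelike nn // ltrN10.
  have [W [dW WE Wpos]] := spacelike_plane_orthogonal tn.
  exists (affine_plane (gamma s0) W); split; first by exists (gamma s0), W.
  (* As [v] is orthogonal to [n s0], only the constancy of the product of [n s0] with [gamma]
     remains. *)
  move=> _ [[s t] /= [Is _] <-]; rewrite /affine_plane /= WE lorentzB lorentzD.
  rewrite lorentzZ (nort _ Is0).2 mulr0 addr0 subr_eq0; apply/eqP.
  apply: (cst_of_derive0 (f := fun z => lorentz (n s0) (gamma z)) hI) => //.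
  move=> {Is} {}s Is; have := is_derive_lorentz (n s0) (dg s Is).
  (* Orthogonality to the velocity at [s] is known for [n s], so [n s0] is first replaced by it. *)
  by rewrite -(ncst s Is) (nort _ Is).1.
move=> [_ [[q0 [W [-> dW Wpos]]] sub]].
have [n [nn nW]] := lorentz_normal_spacelike_plane dW Wpos.
have xW s t : I s -> lorentz n (gamma s + t *: v) = lorentz n q0.
  move=> Is; apply/eqP; rewrite -subr_eq0 -lorentzB; apply/eqP/nW.
  by apply: (sub (cylinder gamma v (s, t))); exists (s, t).
have gW s : I s -> lorentz n (gamma s) = lorentz n q0.
  by move=> Is; rewrite -(xW s 0 Is) scale0r addr0.
(* Two points of one ruling, at parameters 0 and 1, have the same product with [n] and differ by
   [v]. *)
have nv : lorentz n v = 0.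
  by have := xW s0 1 Is0; rewrite scale1r lorentzD gW // => /eqP;
    rewrite -subr_eq0 addrAC subrr add0r => /eqP.
have tn : timelike n by rewrite /timelike nn ltrN10.
have n1 : lorentz_norm n = 1 by rewrite /lorentz_norm nn normrN1 sqrtr1.
exists n, (fun=> n), 0; split => //.
  split=> [|p [Ip _]]; first exact: smooth_on_cst.
  split=> //; apply/(lorentz_diff_cylinder n (dx p Ip)); split => //.
  (* The product of [n] with [gamma] is constant on [I], so its derivative, the product with the
     velocity, vanishes. *)
  have hd := is_derive_lorentz n (dg _ Ip).
  rewrite -(@derive_val _ _ _ _ _ _ _ hd).
  by apply: (derive0_of_cst hI I0 Ip) => // t It; rewrite !gW.
move=> p _; split => //.
by rewrite nn n1 /cosh oppr0 expR0 !mul1r divff // pnatr_eq0.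
Qed.
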